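(* Let $m,n\in\mathbb{N}$ (natural numbers, including $0$) and let $\psi\in\mathsf{MF}$. If $\mathbf{N}\mathbf{A}_{m,n}\vdash\psi$, then $\psi$ is valid on every $(m,n)$-accessible $\mathbf{N}$-frame.
   Context: Language: modal formulae are built from propositional variables (the set $\mathsf{PropVar}$), the constant $\bot$, $\neg$, $\lor$, and $\Box$; $\varphi\to\psi$ abbreviates $\neg\varphi\lor\psi$. $\mathsf{MF}$ is the set of all formulae, $\Box^0\varphi=\varphi$ and $\Box^{k+1}\varphi=\Box\Box^k\varphi$. Logics: $\mathbf{N}$ has as axioms all propositional tautologies in the modal language and as rules modus ponens and necessitation (from $\varphi$ infer $\Box\varphi$). $\mathbf{N}\mathbf{A}_{m,n}$ is $\mathbf{N}$ plus the axiom scheme $\Box^n\varphi\to\Box^m\varphi$ (all $\varphi\in\mathsf{MF}$). Semantics: an $\mathbf{N}$-frame is $(W,\{\prec_\varphi\}_{\varphi\in\mathsf{MF}})$ with $W$ a non-empty set and $\prec_\varphi$ a binary relation on $W$ for each $\varphi\in\mathsf{MF}$. An $\mathbf{N}$-model based on it adds a valuation $V:W\times\mathsf{PropVar}\to\{0,1\}$. Satisfaction: $w\Vdash p$ iff $V(w,p)=1$; $w\nVdash\bot$; $\neg,\lor$ as usual; $w\Vdash\Box\varphi$ iff $w'\Vdash\varphi$ for every $w'\in W$ with $w\prec_\varphi w'$. A formula is valid in a model if it is satisfied at every $w\in W$, and valid on a frame if it is valid in every model based on it. Accessibility: define $x\prec_\varphi^0 y$ iff $x=y$, and for $k\ge1$,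 $x\prec_\varphi^k y$ iff there is $w\in W$ with $x\prec_{\Box^{k-1}\varphi}w$ and $w\prec_\varphi^{k-1}y$. A frame is $(m,n)$-accessible if for all $\varphi\in\mathsf{MF}$ and $x,y\in W$, $x\prec_\varphi^m y$ implies $x\prec_\varphi^n y$. *)

(* Defs.v *)
Set Implicit Arguments.

Inductive MF (PropVar : Type) : Type :=
| Var : PropVar -> MF PropVar
| Bot : MF PropVar
| Not : MF PropVar -> MF PropVar
| Or : MF PropVar -> MF PropVar -> MF PropVar
| Box : MF PropVar -> MF PropVar.

Arguments Bot {PropVar}.

Definition Imp (PropVar : Type) (phi psi : MF PropVar) : MF PropVar :=
  Or (Not phi) psi.

Definition boxn (PropVar : Type) (k : nat) (phi : MF PropVar) : MF PropVar :=
  Nat.iter k (@Box PropVar) phi.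

(* Propositional evaluation: [a] gives arbitrary truth values to the
   propositional atoms of the modal language, which are the variables and the
   boxed formulae; its values on other formulae are not used. *)
Fixpoint prop_eval (PropVar : Type) (a : MF PropVar -> bool)
    (phi : MF PropVar) : bool :=
  match phi with
  | Var _ => a phi
  | Bot => false
  | Not phi1 => negb (prop_eval a phi1)
  | Or phi1 phi2 => orb (prop_eval a phi1) (prop_eval a phi2)
  | Box _ => a phi
  end.

Definition tautology (PropVar : Type) (phi : MF PropVar) : Prop :=
  forall a : MF PropVar -> bool, prop_eval a phi = true.

(* Provability in the logic N extended with the axioms in [Ax].  Necessitation
   applies to all theorems; no distribution axiom for [Box] is assumed. *)
Inductive N_plus (PropVar : Type) (Ax : MF PropVar -> Prop) :
    MF PropVar -> Prop :=
| N_taut : forall phi, tautology phi -> N_plus Ax phi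
| N_ax : forall phi, Ax phi -> N_plus Ax phi
| N_mp : forall phi psi,
    N_plus Ax (Imp phi psi) -> N_plus Ax phi -> N_plus Ax psi
| N_nec : forall phi, N_plus Ax phi -> N_plus Ax (Box phi).

Definition Acc_scheme (PropVar : Type) (m n : nat) (chi : MF PropVar) : Prop :=
  exists phi : MF PropVar, chi = Imp (boxn n phi) (boxn m phi).

Definition NA (PropVar : Type) (m n : nat) : MF PropVar -> Prop :=
  N_plus (@Acc_scheme PropVar m n).

Record N_frame (PropVar : Type) : Type := {
  world : Type;
  world_inhabited : inhabited world;
  rel : MF PropVar -> world -> world -> Prop
}.

Record N_model (PropVar : Type) (F : N_frame PropVar) : Type := {
  valuation : world F -> PropVar -> bool
}.

Fixpoint sat (PropVar : Type) (F : N_frame PropVar) (M : N_model F)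
    (w : world F) (phi : MF PropVar) : Prop :=
  match phi with
  | Var p => valuation M w p = true
  | Bot => False
  | Not phi1 => ~ sat M w phi1
  | Or phi1 phi2 => sat M w phi1 \/ sat M w phi2
  | Box phi1 => forall w' : world F, rel F phi1 w w' -> sat M w' phi1
  end.

Definition valid_in_model (PropVar : Type) (F : N_frame PropVar)
    (M : N_model F) (phi : MF PropVar) : Prop :=
  forall w : world F, sat M w phi.

Definition valid_on_frame (PropVar : Type) (F : N_frame PropVar)
    (phi : MF PropVar) : Prop :=
  forall M : N_model F, valid_in_model M phi.

Fixpoint rel_iter (PropVar : Type) (F : N_frame PropVar) (phi : MF PropVar)
    (k : nat) (x y : world F) : Prop :=
  match k with
  | O => x = y
  | S k' => exists w : world F, rel F (boxn k' phi) x w /\ rel_iter F phi k' w y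
  end.

Definition accessible (PropVar : Type) (m n : nat) (F : N_frame PropVar) :
    Prop :=
  forall (phi : MF PropVar) (x y : world F),
    rel_iter F phi m x y -> rel_iter F phi n x y.

(* Main.v *)
From Stdlib Require Import Bool Classical ClassicalEpsilon.
Require Import Defs.

Set Implicit Arguments.

(** Soundness is an induction on derivations ([N_plus_sound]). The modal content is [sat_boxn]:
    iterated boxes quantify over the successors under [rel_iter], so including the m-step relation
    in the n-step one is what makes the axioms valid ([Acc_scheme_valid]). Tautologies hold because
    satisfaction at a fixed world is itself a Boolean evaluation with boxed formulae as atoms
    ([tautology_valid]). *)

(** Each step of [rel_iter] uses the relation indexed by exactly the formula under the outermost
    box, so both sides unfold in parallel; the world must vary in the induction on [k]. *)
Lemma sat_boxn (PropVar : Type) (F : N_frame PropVar) (M : N_model F)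
    (phi : MF PropVar) (k : nat) (w : world F) :
  sat M w (boxn k phi) <->
  forall y : world F, rel_iter F phi k w y -> sat M y phi.
Proof.
  revert w; induction k as [|k IH]; intros w; simpl.
  - split.
    + intros Hw y <-; exact Hw.
    + intros H; exact (H w eq_refl).
  - split.
    + intros Hw y (v & Hwv & Hvy).
      exact (proj1 (IH v) (Hw v Hwv) y Hvy).
    + intros H v Hwv; apply IH; intros y Hvy.
      apply H; exists v; split; assumption.
Qed.

Lemma sat_Imp (PropVar : Type) (F : N_frame PropVar) (M : N_model F)
    (w : world F) (phi psi : MF PropVar) :
  sat M w (Imp phi psi) <-> (sat M w phi -> sat M w psi).
Proof.
  simpl; split.
  - intros [H | H] Hphi; [contradiction | exact H].
  (* Classical: implication is encoded as a disjunction. *)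
  - apply imply_to_or.
Qed.

(** [prop_eval] expects Booleans, whereas satisfaction of a box is a quantified proposition;
    informative excluded middle bridges the two. *)
Definition sat_bool (PropVar : Type) (F : N_frame PropVar) (M : N_model F)
    (w : world F) (phi : MF PropVar) : bool :=
  if excluded_middle_informative (sat M w phi) then true else false.

Lemma prop_eval_sat_bool (PropVar : Type) (F : N_frame PropVar)
    (M : N_model F) (w : world F) (phi : MF PropVar) :
  prop_eval (sat_bool M w) phi = true <-> sat M w phi.
Proof.
  assert (Hatom : forall chi, sat_bool M w chi = true <-> sat M w chi).
  { intros chi; unfold sat_bool.
    destruct (excluded_middle_informative (sat M w chi));
      split; easy. }
  induction phi as [p | | phi IH | phi1 IH1 phi2 IH2 | phi _].
  - exact (Hatom (Var p)).
  - simpl; split; easy.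
  - simpl; rewrite negb_true_iff, <- not_true_iff_false, IH; reflexivity.
  - simpl; rewrite orb_true_iff, IH1, IH2; reflexivity.
  (* A box is an atom for [prop_eval], so no induction hypothesis enters. *)
  - exact (Hatom (Box phi)).
Qed.

Lemma tautology_valid (PropVar : Type) (F : N_frame PropVar)
    (phi : MF PropVar) :
  tautology phi -> valid_on_frame F phi.
Proof.
  intros Htaut M w; apply prop_eval_sat_bool, Htaut.
Qed.

Lemma Acc_scheme_valid (PropVar : Type) (m n : nat) (F : N_frame PropVar)
    (chi : MF PropVar) :
  accessible m n F -> Acc_scheme m n chi -> valid_on_frame F chi.
Proof.
  intros Hacc [phi ->] M w.
  apply sat_Imp; rewrite !sat_boxn; intros Hn y Hy.
  (* Accessibility turns the m-step successor [y] into an n-step one, where [Hn] gives [phi]. *)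
  apply Hn, Hacc, Hy.
Qed.

Lemma N_plus_sound (PropVar : Type) (Ax : MF PropVar -> Prop)
    (F : N_frame PropVar) (psi : MF PropVar) :
  (forall chi, Ax chi -> valid_on_frame F chi) ->
  N_plus Ax psi -> valid_on_frame F psi.
Proof.
  intros HAx Hpsi M.
  (* The model is fixed but the world is not: necessitation needs the premise at every world. *)
  induction Hpsi as [phi Htaut | phi Hphi | phi psi _ IHimp _ IHphi | phi _ IH];
    intros w.
  - exact (tautology_valid Htaut M w).
  - exact (HAx phi Hphi M w).
  - exact (proj1 (sat_Imp M w phi psi) (IHimp w) (IHphi w)).
  - intros w' _; apply IH.
Qed.

Theorem theorem3p3 (PropVar : Type) (m n : nat) (psi : MF PropVar) :
  NA m n psi ->
  forall F : N_frame PropVar, accessible m n F -> valid_on_frame F psi.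
Proof.
  intros Hpsi F Hacc.
  apply (@N_plus_sound _ (@Acc_scheme PropVar m n)); [| exact Hpsi].
  intros chi; apply Acc_scheme_valid, Hacc.
Qed.
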